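(* Let $l\ge3$ and $m\ge1$ be integers and let $A$ be an ${[m]\choose l}$-matrix. Then $$\operatorname{rk}A\ \ge\ \frac{m-2l+2}{l-1}.$$ If, moreover, $A$ is even, then $$\operatorname{rk}A\ \ge\ \frac{2(m-2l+2)}{l}.$$
   Context: $[m]:=\{1,2,\ldots,m\}$. The rank $\operatorname{rk}$ is over the field $\mathbb{Z}_2$. Write $i$ for $\{i\}$ and $F-i$ for $F\setminus\{i\}$. For an integer $l\ge3$ and a finite set $U$, a ${U\choose l}$-matrix is a symmetric square matrix $A$ with entries in $\mathbb{Z}_2$, whose rows and whose columns correspond to all $l$-element subsets of $U$, such that the following hold: (independence) $A_{P,Q}=0$ if $P\cap Q=\emptyset$; (linear dependence) for each $(l+1)$-element subset $F\subset U$ and $l$-element subset $P\subset U$, $\sum_{i\in F}A_{F-i,P}=0$; (non-triviality) for each $i\in U$ and each $(2l-2)$-element subset $F\subset U-i$ we have $A_{F,i}=1$, where $$A_{F,i}:=\sum_{\{\sigma,\tau\}\,:\,F=\sigma\sqcup\tau,\ |\sigma|=|\tau|=l-1}A_{i\sqcup\sigma,\,i\sqcup\tau},$$ the sum being over all unordered partitions of $F$ into two $(l-1)$-element subsets. A matrix over $\mathbb{Z}_2$ is called even if all the entries on its main diagonal are $0$. *)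

(* Defs.v *)
From mathcomp Require Import all_boot all_order all_algebra.

Set Implicit Arguments.
Unset Strict Implicit.
Unset Printing Implicit Defensive.

Import Order.TTheory GRing.Theory Num.Theory.
Local Open Scope ring_scope.

Definition lsubset (U : finType) (l : nat) := {P : {set U} | #|P| == l}.

(* Square matrices over Z_2 whose rows and columns are indexed, through
   [enum_rank], by the l-element subsets of U. *)
Definition subset_matrix (U : finType) (l : nat) :=
  'M['F_2]_#|{: lsubset U l}|.

(* The entry A_{P,Q}, with P and Q given as plain sets; it is only meaningful
   for #|P| = #|Q| = l, and is 0 by convention otherwise. *)
Definition entry (U : finType) (l : nat) (A : subset_matrix U l)
    (P Q : {set U}) : 'F_2 :=
  match (insub P : option (lsubset U l)), (insub Q : option (lsubset U l)) with
  | Some p, Some q => A (enum_rank p) (enum_rank q)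
  | _, _ => 0
  end.

(* The summand A_{i |_| s, i |_| t} attached to an unordered pair S = {s, t}.
   The pair is read off in the order of [enum S], which is irrelevant when A
   is symmetric: see [pair_entryE]. *)
Definition pair_entry (U : finType) (l : nat) (A : subset_matrix U l) (i : U)
    (S : {set {set U}}) : 'F_2 :=
  entry A (i |: nth set0 (enum S) 0) (i |: nth set0 (enum S) 1).

Definition unordered_halving (U : finType) (l : nat) (F : {set U})
    (S : {set {set U}}) : bool :=
  [&& partition S F, #|S| == 2 & [forall s in S, #|s| == l.-1]].

(* A_{F,i} *)
Definition halving_sum (U : finType) (l : nat) (A : subset_matrix U l)
    (F : {set U}) (i : U) : 'F_2 :=
  \sum_(S : {set {set U}} | unordered_halving l F S) pair_entry A i S.

Record is_choose_matrix (U : finType) (l : nat) (A : subset_matrix U l) :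
    Prop := IsChooseMatrix {
  cm_symmetric : A^T = A;
  cm_independence : forall P Q : {set U}, #|P| = l -> #|Q| = l ->
    P :&: Q = set0 -> entry A P Q = 0;
  cm_linear_dependence : forall F P : {set U}, #|F| = l.+1 -> #|P| = l ->
    \sum_(i in F) entry A (F :\ i) P = 0;
  cm_nontriviality : forall (i : U) (F : {set U}), #|F| = (2 * l - 2)%N ->
    F \subset [set: U] :\ i -> halving_sum A F i = 1
}.

Definition even_matrix (n : nat) (A : 'M['F_2]_n) : Prop :=
  forall k : 'I_n, A k k = 0.

Lemma entry_sym (U : finType) (l : nat) (A : subset_matrix U l)
    (P Q : {set U}) : A^T = A -> entry A P Q = entry A Q P.
Proof.
move=> symA; rewrite /entry.
by case: (insub P) => [p|]; case: (insub Q) => [q|] //; rewrite -{1}symA mxE.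
Qed.

Lemma pair_entryE (U : finType) (l : nat) (A : subset_matrix U l) (i : U)
    (s t : {set U}) :
  A^T = A -> s != t ->
  pair_entry A i [set s; t] = entry A (i |: s) (i |: t).
Proof.
move=> symA st; rewrite /pair_entry.
have : perm_eq (enum [set s; t]) [:: s; t].
  apply: uniq_perm; rewrite ?enum_uniq //= ?inE ?st // => x.
  by rewrite mem_enum !inE.
move=> pe; have us := enum_uniq [set s; t].
have : size (enum [set s; t]) = 2 by rewrite (perm_size pe).
have ms : enum [set s; t] =i [:: s; t] by exact: perm_mem.
case: (enum _) us ms => [|x [|y [|]]] //= /andP[]; rewrite inE => xy _ ms _.
have := ms x; have := ms y; rewrite !inE !eqxx orbT /=.
move: xy => /[swap] /esym/orP[]/eqP-> /[swap] /esym/orP[]/eqP->;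
  rewrite ?eqxx // => _.
exact: entry_sym.
Qed.

(* Main.v *)
(** Write A_{P,Q} = y_P M y_Q^T and induct on the rank of M.

If A_{P,P} = 0 for all P, pick P, Q with A_{P,Q} = 1 and replace M by its
projection off the hyperbolic plane spanned by y_P, y_Q: the rank drops by 2,
and by independence no entry indexed by l-subsets of X \ P changes.  So l
points cost rank 2.

If A_{P,P} = 1 for some P, choose p in P and split off the line of y_P; this adds
A_{R,P} A_{S,P} to A_{R,S} and lowers the rank by 1.  Restricted to
X \ (P - p), the axioms survive, since only sets containing p meet P; so l - 1
points cost rank 1.  Only non-triviality at i = p is delicate: the change there
is the sum of f(s) f(F \ s) over halvings of F, where f(s) = A_{p+s,P} is a
cocycle, and this sum vanishes. *)

Require Import Defs.
From mathcomp Require Import all_boot all_order all_algebra.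
From mathcomp Require Import zify lra.

Set Implicit Arguments.
Unset Strict Implicit.
Unset Printing Implicit Defensive.

Import Order.TTheory GRing.Theory Num.Theory.
Local Open Scope ring_scope.

(** * Splitting a line or a hyperbolic plane off a symmetric form over Z_2 *)

Lemma addrr_F2 (x : 'F_2) : x + x = 0.
Proof. exact: (addrr_pchar2 (pchar_Fp _)). Qed.

Lemma F2_neq0 (x : 'F_2) : x != 0 -> x = 1.
Proof. by case: x => [[|[|]]] //= i _; apply: val_inj. Qed.

(* Z annihilates the new matrix, and its row space meets the left kernel of M
   trivially. *)
Lemma mxrank_schur (K : fieldType) (n k : nat) (M : 'M[K]_n)
    (Z : 'M[K]_(k, n)) (J : 'M[K]_k) :
  Z *m M *m Z^T *m J = 1%:M ->
  (\rank (M - M *m Z^T *m J *m Z *m M)%R + k <= \rank M)%N.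
Proof.
move=> ZJ; set M' := M - _.
have ZM'0 : Z *m M' = 0.
  by rewrite mulmxBr !mulmxA ZJ mul1mx subrr.
have sub : (kermx M + Z <= kermx M')%MS.
  rewrite addsmx_sub; apply/andP; split; apply/sub_kermxP => //.
  by rewrite mulmxBr !mulmxA mulmx_ker !mul0mx subrr.
have rZM : \rank (Z *m M) = k.
  apply/eqP; rewrite eqn_leq rank_leq_row /= -[leqLHS](mxrank1 K) -ZJ.
  by rewrite -[X in \rank X]mulmxA mxrankM_maxl.
have := mxrankS sub; have := mxrank_mul_ker Z M; have := mxrank_sum_cap (kermx M) Z.
rewrite rZM capmxC !mxrank_ker.
have := rank_leq_row M; have := rank_leq_row M'; lia.
Qed.

(** The vectors [y] stay fixed through the induction and only [M] is replaced, so the form on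
    subsets changes while the rank of a single matrix is tracked. *)
Definition gram (U : finType) (n : nat) (M : 'M['F_2]_n)
    (y : {set U} -> 'rV['F_2]_n) (P Q : {set U}) : 'F_2 :=
  (y P *m M *m (y Q)^T) 0 0.

Section Gram.
Context {U : finType} {n : nat}.
Implicit Types (M : 'M['F_2]_n) (y : {set U} -> 'rV['F_2]_n) (P Q R S : {set U}).

Lemma gram_scalar M y P Q : y P *m M *m (y Q)^T = (gram M y P Q)%:M.
Proof. exact: mx11_scalar. Qed.

Lemma gram_sym M y P Q : M^T = M -> gram M y P Q = gram M y Q P.
Proof.
move=> symM; transitivity ((y P *m M *m (y Q)^T)^T 0 0); first by rewrite mxE.
by rewrite !trmx_mul trmxK symM mulmxA.
Qed.

Lemma gram_rank_one M y P Q R S :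
  (y R *m (M *m (y P)^T *m y Q *m M) *m (y S)^T) 0 0 = gram M y R P * gram M y Q S.
Proof. by rewrite !mulmxA gram_scalar mul_scalar_mx -!scalemxAl mxE. Qed.

(** [mxrank_schur] with the single row [y P] and [J = 1]; the minus sign of the Schur complement
    becomes a plus in characteristic 2. *)
Lemma split_anisotropic M y P : M^T = M -> gram M y P P = 1 ->
  exists M', [/\ M'^T = M', (\rank M' < \rank M)%N &
    forall R S, gram M' y R S = gram M y R S + gram M y R P * gram M y S P].
Proof.
move=> symM GP; exists (M - M *m (y P)^T *m 1%:M *m y P *m M); split.
- by rewrite linearB /= !trmx_mul trmxK symM trmx1 !mulmxA.
- rewrite -addn1; apply: mxrank_schur; by rewrite gram_scalar GP mulmx1.
- move=> R S; rewrite [gram M y S P]gram_sym // -gram_rank_one.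
  rewrite {1}/gram mulmxBr mulmxBl mulmx1 [LHS]mxE [X in _ + X]mxE.
  by rewrite oppr_pchar2 // pchar_Fp.
Qed.

Lemma split_hyperbolic M y P Q : M^T = M -> gram M y P P = 0 -> gram M y Q Q = 0 ->
  gram M y P Q = 1 ->
  exists M', [/\ M'^T = M', (\rank M' + 2 <= \rank M)%N &
    forall R S, gram M' y R S = gram M y R S
      + (gram M y R P * gram M y S Q + gram M y R Q * gram M y S P)].
Proof.
move=> symM GP GQ GPQ.
(* The Gram matrix of [y P], [y Q] is the swap matrix, which is its own inverse; hence this [J]. *)
pose Z : 'M_(1 + 1, n) := col_mx (y P) (y Q).
pose J : 'M['F_2]_(1 + 1) := block_mx 0 1%:M 1%:M 0.
have symJ : J^T = J by rewrite tr_block_mx !trmx0 !trmx1.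
have ZJ : Z *m M *m Z^T *m J = 1%:M.
  rewrite /Z mul_col_mx tr_col_mx mul_col_row !gram_scalar GP GQ [gram _ _ Q P]gram_sym //.
  rewrite GPQ raddf0 mulmx_block !mulmx1 !mul0mx !mulmx0 !addr0 !add0r.
  by rewrite -scalar_mx_block.
exists (M - M *m Z^T *m J *m Z *m M); split.
- by rewrite linearB /= !trmx_mul trmxK symM symJ !mulmxA.
- exact: mxrank_schur ZJ.
- move=> R S.
  have -> : M *m Z^T *m J *m Z *m M = M *m (y Q)^T *m (y P *m M) + M *m (y P)^T *m (y Q *m M).
    rewrite /Z tr_col_mx mul_mx_row mul_row_block !mulmx1 !mulmx0 addr0 add0r mul_row_col.
    by rewrite mulmxDl !mulmxA.
  rewrite [gram M y S P]gram_sym // [gram M y S Q]gram_sym // -!gram_rank_one.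
  rewrite {1}/gram mulmxBr mulmxBl mulmxDr mulmxDl [LHS]mxE [X in _ + X]mxE.
  by rewrite oppr_pchar2 ?pchar_Fp // [X in _ + X]mxE !mulmxA [X in _ + X]addrC.
Qed.
End Gram.

(** * The axioms for a form on subsets of a ground set X that may shrink *)

Section ChooseForm.
Context {U : finType}.
Implicit Types (F H P Q R S X Y s : {set U}).

(* Expand f (F \ s) over the cone with apex a: for each fixed j, the map tau
   (complement in F - j, keeping a) is an involution of the remaining terms
   that exchanges the sets containing b with those avoiding it. *)
Lemma cocycle_halving_sum0 (k : nat) (f : {set U} -> 'F_2) F (a : U) :
  (2 <= k)%N -> #|F| = (2 * k)%N -> a \in F ->
  (forall H, H \subset F -> #|H| = k.+1 -> \sum_(i in H) f (H :\ i) = 0) ->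
  \sum_(s : {set U} | [&& s \subset F, #|s| == k & a \in s]) f s * f (F :\: s) = 0.
Proof.
move=> k2 cF aF f0.
transitivity (\sum_(s : {set U} | [&& s \subset F, #|s| == k & a \in s])
    \sum_(j in F :\: s) f s * f ((a |: F :\: s) :\ j)).
  apply: eq_bigr => s /and3P[sF /eqP cs as_]; rewrite -mulr_sumr; congr (_ * _).
  have aFs : a \notin F :\: s by rewrite inE as_.
  have := f0 (a |: F :\: s); rewrite big_setU1 //= setU1K //.
  move=> /[!cardsU1] /[!aFs] /[!cardsD] /[!(setIidPr sF)] /[!cF] /[!cs] h.
  apply/eqP; rewrite -subr_eq0 oppr_pchar2 ?pchar_Fp // h //; last by lia.
  by rewrite subUset sub1set aF subsetDl.
rewrite (exchange_big_dep (mem (F :\ a))) /=; last first.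
  move=> s j /and3P[_ _ as_]; rewrite !inE => /andP[js ->]; rewrite andbT.
  by apply: contraNneq js => ->.
apply: big1 => j; rewrite !inE => /andP[ja jF].
(* Since [2 <= k], F has at least four elements, so a point other than a and j remains. *)
have [b] : exists b, b \in F :\ a :\ j.
  apply/set0Pn; rewrite -card_gt0 (cardsD1 a) aF in cF *.
  by have := cardsD1 j (F :\ a); rewrite !inE ja jF; lia.
rewrite !inE => /and3P[bj ba bF].
pose tau s := (a |: F :\: s) :\ j.
pose D s := [&& s \subset F, #|s| == k & a \in s] && (j \in F :\: s).
have tauD s : D s -> D (tau s).
  move=> /andP[/and3P[sF /eqP cs as_]] /[dup] jFs /setDP[_ js].
  apply/andP; split; last by rewrite !inE eqxx jF.
  apply/and3P; split.
  - by rewrite subDset subUset sub1set inE aF orbT subsetU // subsetDl orbT.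
  - have := cardsD1 j (a |: F :\: s); rewrite cardsU1 cardsD (setIidPr sF) cs cF !inE as_ js jF.
    by rewrite orbT /= /tau; lia.
  - by rewrite !inE eqxx eq_sym ja.
have tauK s : D s -> tau (tau s) = s.
  move=> /andP[/and3P[/subsetP sF _ as_]] /setDP[_ js]; apply/setP => x; rewrite !inE.
  have [->|xj] := eqVneq x j; first by rewrite (negbTE js).
  have [->|xa] := eqVneq x a; first by rewrite as_.
  by have := sF x; case: (x \in s); case: (x \in F) => //= ->.
have btau s : (b \in tau s) = (b \notin s).
  by rewrite !inE bj (negbTE ba) bF andbT.
(* The product [f s * f (tau s)] is invariant under [tau], so the terms with b in s and those
   without have equal sums, which cancel in characteristic 2. *)
rewrite (bigID (fun s : {set U} => b \in s)) /=.
rewrite [X in _ + X](reindex_onto tau tau) /=; last by move=> s /andP[/tauK].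
rewrite [X in _ + X](_ : _ = \sum_(s | D s && (b \in s)) f s * f (tau s)) ?addrr_F2 //.
apply: eq_big => [s|s /andP[/andP[Dts _] /eqP tauKs]]; last by rewrite -/(tau _) tauKs mulrC.
rewrite btau negbK -/(D _); apply/idP/idP.
  by move=> /andP[/andP[/tauD Ds ->] /eqP tauKs]; rewrite andbT; move: Ds; rewrite tauKs.
by move=> /andP[Ds ->]; rewrite tauD //= tauK.
Qed.

(* Fixing the half containing a makes the unordered sum A_{F,i} a sum over
   sets; see [halving_sumE]. *)
Record choose_form (l : nat) X (G : {set U} -> {set U} -> 'F_2) : Prop := ChooseForm {
  cf_independence : forall P Q, P \subset X -> Q \subset X -> #|P| = l -> #|Q| = l ->
    [disjoint P & Q] -> G P Q = 0;
  cf_linear_dependence : forall F P, F \subset X -> P \subset X -> #|F| = l.+1 ->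
    #|P| = l -> \sum_(i in F) G (F :\ i) P = 0;
  cf_nontriviality : forall (i a : U) F, i \in X -> F \subset X :\ i ->
    #|F| = (2 * l - 2)%N -> a \in F ->
    \sum_(s : {set U} | [&& s \subset F, #|s| == l.-1 & a \in s])
      G (i |: s) (i |: F :\: s) = 1 }.

Lemma choose_formS l X Y G : Y \subset X -> choose_form l X G -> choose_form l Y G.
Proof.
move=> YX [ind lin non]; split.
- by move=> P Q PY QY; apply: ind; apply: subset_trans YX.
- by move=> F P FY PY; apply: lin; apply: subset_trans YX.
- move=> i a F iY FY; apply: non; first exact: subsetP iY.
  by apply: subset_trans FY _; apply: setSD.
Qed.

Lemma card_half_pair (l : nat) (i : U) F s : i \notin F -> #|F| = (2 * l - 2)%N ->
  s \subset F -> #|s| == l.-1 -> (0 < l)%N ->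
  #|i |: s| = l /\ #|i |: F :\: s| = l.
Proof.
move=> iF cF sF /eqP cs l0; have is_ : i \notin s by apply: contraNN iF; apply: subsetP.
rewrite !cardsU1 is_ inE negb_and iF orbT cardsD (setIidPr sF) cs cF; lia.
Qed.

(** The axioms evaluate the form only at pairs of l-subsets of X; this is where a split form has to
    be compared with the old one. *)
Lemma choose_form_eq l X G G' : (2 <= l)%N ->
  (forall P Q, P \subset X -> Q \subset X -> #|P| = l -> #|Q| = l -> G P Q = G' P Q) ->
  choose_form l X G -> choose_form l X G'.
Proof.
move=> l2 eqG [ind lin non]; split.
- by move=> P Q PX QX cP cQ dPQ; rewrite -eqG // ind.
- move=> F P FX PX cF cP; rewrite -[RHS](lin F P) //; apply: eq_bigr => i iF.
  rewrite eqG //; first exact: subset_trans (subsetDl _ _) FX.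
  by have := cardsD1 i F; rewrite iF cF => -[].
- move=> i a F iX FX cF aF; rewrite -[RHS](non i a F) //.
  have [iF FX'] : i \notin F /\ F \subset X.
    by move: FX; rewrite subsetD1 => /andP[].
  apply: eq_bigr => s /and3P[sF cs _]; have [|c1 c2] := card_half_pair iF cF sF cs; first lia.
  rewrite eqG // subUset sub1set iX //=; first exact: subset_trans sF FX'.
  by apply: subset_trans (subsetDl _ _) FX'.
Qed.

(** The size of X leaves room for a point i and a (2l-2)-set F avoiding it; the non-triviality sum
    is 1, so one of its terms is nonzero. *)
Lemma choose_form_neq0 l X G : (2 <= l)%N -> choose_form l X G -> (2 * l - 2 < #|X|)%N ->
  exists P Q, [/\ P \subset X, Q \subset X, #|P| = l, #|Q| = l & G P Q = 1].
Proof.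
move=> l2 [_ _ non] ltX.
have [i iX] : exists i, i \in X by apply/set0Pn; rewrite -card_gt0; lia.
have cXi : (2 * l - 2 <= #|X :\ i|)%N by have := cardsD1 i X; rewrite iX; lia.
have [F] : exists F, F \in [set F : {set U} | F \subset X :\ i & #|F| == (2 * l - 2)%N].
  by apply/set0Pn; rewrite -card_gt0 cards_draws bin_gt0.
rewrite inE => /andP[FX /eqP cF].
have [a aF] : exists a, a \in F by apply/set0Pn; rewrite -card_gt0; lia.
have [iF FX'] : i \notin F /\ F \subset X.
  by move: FX; rewrite subsetD1 => /andP[].
have /eqP := non i a F iX FX cF aF; case: (pickP (fun s : {set U} =>
  [&& s \subset F, #|s| == l.-1 & a \in s] && (G (i |: s) (i |: F :\: s) != 0))).
  move=> s /andP[/and3P[sF cs _] /F2_neq0 Gs] _.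
  have [|c1 c2] := card_half_pair iF cF sF cs; first lia.
  exists (i |: s), (i |: F :\: s); split => //; rewrite subUset sub1set iX //=.
    exact: subset_trans sF FX'.
  by apply: subset_trans (subsetDl _ _) FX'.
move=> no; rewrite big1 1?eq_sym ?oner_eq0 // => s hs.
by have := no s; rewrite hs /= => /negbFE/eqP.
Qed.

Lemma choose_form_anisotropic_split l X G P p : (3 <= l)%N -> choose_form l X G ->
  P \subset X -> #|P| = l -> p \in P ->
  choose_form l (X :\: (P :\ p)) (fun R S => G R S + G R P * G S P).
Proof.
move=> l3 cG PX cP pP; set Y := X :\: _.
have YX : Y \subset X by apply: subsetDl.
have GP0 R : R \subset Y -> #|R| = l -> p \notin R -> G R P = 0.
  move=> RY cR pR; apply: (cf_independence cG) => //; first exact: subset_trans YX.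
  rewrite disjoint_subset; apply/subsetP => x xR; rewrite inE; apply/negP => xP.
  have := subsetP RY x xR; rewrite !inE xP andbT negbK => /andP[/eqP xp _].
  by rewrite -xp xR in pR.
have [ind lin non] := choose_formS YX cG.
split.
- move=> R S RY SY cR cS dRS; rewrite ind // add0r.
  (* Disjoint R and S cannot both contain p, so one factor of the correction vanishes. *)
  have [pR|pR] := boolP (p \in R); last by rewrite GP0 // mul0r.
  by rewrite [G S P]GP0 ?mulr0 // (disjointFr dRS pR).
(* The common factor [G S P] comes out of the correction. The remaining relation is taken in X,
   because P is not contained in Y. *)
- move=> F S FY SY cF cS; rewrite big_split /= lin // add0r -mulr_suml.
  by rewrite (cf_linear_dependence cG) ?mul0r //; apply: subset_trans YX.
- move=> i a F iY FY cF aF; rewrite big_split /= non //.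
  have [iF FY'] : i \notin F /\ F \subset Y.
    by move: FY; rewrite subsetD1 => /andP[].
  have sub s : s \subset F -> (i |: s \subset Y) /\ (i |: F :\: s \subset Y).
    move=> sF; rewrite !subUset !sub1set iY /=; split; first exact: subset_trans FY'.
    exact: subset_trans (subsetDl _ _) FY'.
  suff -> : \sum_(s : {set U} | [&& s \subset F, #|s| == l.-1 & a \in s])
      G (i |: s) P * G (i |: F :\: s) P = 0 by rewrite addr0.
  (* If i differs from p, then p lies in at most one of the two sets, so each product has a zero
     factor. *)
  have [ip|ip] := eqVneq i p; last first.
    apply: big1 => s /and3P[sF cs _]; have [|c1 c2] := card_half_pair iF cF sF cs; first lia.
    have [s1 s2] := sub s sF; have [ps|ps] := boolP (p \in s).
      by rewrite [X in _ * X]GP0 ?mulr0 // !inE ps eq_sym (negbTE ip).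
    by rewrite GP0 ?mul0r // !inE eq_sym (negbTE ip).
  (* The bound [3 <= l] gives the required [2 <= l.-1]. The cocycle condition on H is the linear
     dependence of G on [i |: H] against P: the term omitting i is [G H P], which is 0 because H
     avoids p = i. *)
  apply: (@cocycle_halving_sum0 l.-1 (fun s => G (i |: s) P)) => //; [lia|lia|].
  move=> H HF cH; have iH : i \notin H by apply: contraNN iF; apply: subsetP.
  have iHY : i |: H \subset Y by rewrite subUset sub1set iY (subset_trans HF).
  have := cf_linear_dependence cG (subset_trans iHY YX) PX.
  rewrite cardsU1 iH big_setU1 //= setU1K // GP0 ?add0r; last 3 first.
  - exact: subset_trans HF FY'.
  - by rewrite cH; lia.
  - by rewrite -ip.
  move=> h; rewrite -[RHS]h; [|lia|by []].
  apply: eq_bigr => j jH; congr (G _ P); apply/setP => x; rewrite !inE.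
  by have [->|//] := eqVneq x i; rewrite andbT; apply/esym; apply: contraNneq iH => ->.
Qed.

(** * The two rank bounds in natural-number form *)

(** The diagonal is assumed to vanish only at l-subsets of X: this is what passes to X \ P, as the
    split may create nonzero diagonal values at sets meeting P. *)
Lemma even_choose_form_rank n (M : 'M['F_2]_n) y l X : (2 <= l)%N -> M^T = M ->
  choose_form l X (gram M y) ->
  (forall P, P \subset X -> #|P| = l -> gram M y P P = 0) ->
  (2 * #|X| <= 2 * (2 * l - 2) + l * \rank M)%N.
Proof.
move=> l2; have [r] := ubnP (\rank M); elim: r M X => // r IH M X ltr symM cG evenG.
have [leX|ltX] := leqP #|X| (2 * l - 2); first lia.
have [P [Q [PX QX cP cQ GPQ]]] := choose_form_neq0 l2 cG ltX.
have [M' [symM' rkM' gM']] := split_hyperbolic symM (evenG _ PX cP) (evenG _ QX cQ) GPQ.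
have XPX : X :\: P \subset X by apply: subsetDl.
(* Each of the two correction terms has a factor pairing R or S with P, which is 0 off P by
   independence. Hence removing P suffices and Q may stay. *)
have eqG R S : R \subset X :\: P -> S \subset X :\: P -> #|R| = l -> #|S| = l ->
    gram M y R S = gram M' y R S.
  have GP0 (T : {set U}) : T \subset X :\: P -> #|T| = l -> gram M y T P = 0.
    rewrite subsetD => /andP[TX TP] cT; exact: (cf_independence cG).
  by move=> RXP SXP cR cS; rewrite gM' !GP0 // mul0r mulr0 !addr0.
have := IH M' (X :\: P); rewrite cardsD (setIidPr PX) cP => /(_ _ symM').
have := subset_leq_card PX; rewrite cP => lX h.
suff : (2 * (#|X| - l) <= 2 * (2 * l - 2) + l * \rank M')%N by nia.
apply: h; first lia.
  exact: choose_form_eq eqG (choose_formS XPX cG).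
by move=> R RXP cR; rewrite -eqG // evenG // (subset_trans RXP).
Qed.

Lemma choose_form_rank n (M : 'M['F_2]_n) y l X : (3 <= l)%N -> M^T = M ->
  choose_form l X (gram M y) -> (#|X| <= 2 * l - 2 + (l - 1) * \rank M)%N.
Proof.
move=> l3; have [r] := ubnP (\rank M); elim: r M X => // r IH M X ltr symM cG.
case: (pickP (fun P : {set U} => [&& P \subset X, #|P| == l & gram M y P P != 0])); last first.
  move=> evenG; have := @even_choose_form_rank n M y l X (ltnW l3) symM cG.
  (* The even bound implies the general one because l <= 2(l - 1). *)
  move=> h; suff : (2 * #|X| <= 2 * (2 * l - 2) + l * \rank M)%N by nia.
  by apply: h => P PX cP; have := evenG P; rewrite PX cP eqxx /= => /negbFE/eqP.
move=> P /and3P[PX /eqP cP /F2_neq0 GP].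
have [p pP] : exists p, p \in P by apply/set0Pn; rewrite -card_gt0; lia.
have [M' [symM' rkM' gM']] := split_anisotropic symM GP.
have := IH M' (X :\: (P :\ p)); rewrite cardsD (setIidPr _); last first.
  exact: subset_trans (subsetDl _ _) PX.
have := cardsD1 p P; rewrite pP cP => cPp.
move=> /(_ _ symM') h.
suff : (#|X| - #|P :\ p| <= 2 * l - 2 + (l - 1) * \rank M')%N by nia.
apply: h; first lia.
have := choose_form_anisotropic_split l3 cG PX cP pP.
by apply: choose_form_eq => [|R S _ _ _ _]; [lia|rewrite gM'].
Qed.
End ChooseForm.

(** * From matrices and unordered halvings to choose forms *)

Section Entries.
Context {U : finType} {l : nat}.
Implicit Types (A : subset_matrix U l) (F P Q s : {set U}).

Lemma unordered_halving_set2 F (s t : {set U}) : s != t ->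
  unordered_halving l F [set s; t] =
  [&& s :|: t == F, [disjoint s & t], s != set0, t != set0, #|s| == l.-1 & #|t| == l.-1].
Proof.
move=> st; rewrite /unordered_halving /partition cards2 st /=.
have -> : cover [set s; t] = s :|: t by rewrite /cover big_setU1 ?inE //= big_set1.
have -> : trivIset [set s; t] = [disjoint s & t].
  rewrite /trivIset big_setU1 ?inE //= big_set1 /cover big_setU1 ?inE //= big_set1.
  by rewrite eq_sym leq_card_setU.
have -> : [forall s0 in [set s; t], #|s0| == l.-1] = (#|s| == l.-1) && (#|t| == l.-1).
  apply/forall_inP/andP => [h|[hs ht] x]; first by rewrite !h ?inE ?eqxx ?orbT.
  by rewrite !inE => /orP[]/eqP->.
by rewrite !inE negb_or ![set0 == _]eq_sym -!andbA.
Qed.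

(** A halving is determined by its block containing a: sending s to {s, F \ s} and S to [pblock S a]
    are mutually inverse. Symmetry of A makes the order within a pair irrelevant. *)
Lemma halving_sumE A (i a : U) F : (2 <= l)%N -> A^T = A -> #|F| = (2 * l - 2)%N -> a \in F ->
  halving_sum A F i = \sum_(s : {set U} | [&& s \subset F, #|s| == l.-1 & a \in s])
    entry A (i |: s) (i |: F :\: s).
Proof.
move=> l2 symA cF aF; rewrite /halving_sum.
rewrite (reindex_onto (fun s : {set U} => [set s; F :\: s]) (fun S => pblock S a)) /=; last first.
  move=> S hS; have := hS; rewrite /unordered_halving => /and3P[/and3P[/eqP covS tS _] S2 _].
  have /cards2P[s [t [st eS]]] := S2; have aS : a \in cover S by rewrite covS.
  have := pblock_mem aS; have := mem_pblock S a; rewrite aS.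
  move: hS; rewrite eS unordered_halving_set2 // => /and4P[/eqP<- dst _ _] _.
  have Us : (s :|: t) :\: s = t.
    by rewrite setDUl setDv set0U; apply/setDidPl; rewrite disjoint_sym.
  have Ut : (s :|: t) :\: t = s by rewrite setDUl setDv setU0; apply/setDidPl.
  by rewrite !inE => /orP[]/eqP->; rewrite ?Us ?Ut // setUC.
have neq s : s != F :\: s.
  by apply/eqP => /setP/(_ a); rewrite inE aF andbT; case: (a \in s).
apply: eq_big => [s|s _]; last by rewrite pair_entryE // neq.
rewrite unordered_halving_set2 ?neq //; apply/andP/and3P.
  move=> [/and5P[/eqP UF dsF s0 t0 /andP[cs ct]] /eqP ps]; split=> //.
    by rewrite -UF subsetUl.
  by rewrite -ps mem_pblock /cover big_setU1 ?inE ?neq //= big_set1 -in_setU UF.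
move=> [sF cs as_]; have ct : #|F :\: s| = l.-1.
  by rewrite cardsD (setIidPr sF) cF (eqP cs); lia.
have dsF : [disjoint s & F :\: s] by rewrite -setI_eq0 setIDA setIC setDIl setDv setI0 eqxx.
have hlv : unordered_halving l F [set s; F :\: s].
  rewrite unordered_halving_set2 ?neq // dsF -!card_gt0 ct (eqP cs) !eqxx.
  rewrite setDE setUIr setUCr setIT (setUidPr sF) eqxx /=; lia.
move: (hlv); rewrite unordered_halving_set2 ?neq // => ->; split=> //.
apply/eqP/def_pblock; rewrite ?inE ?eqxx //; by move: hlv; rewrite /unordered_halving => /and3P[/and3P[]].
Qed.

(** Standard basis vectors, making A its own Gram matrix. The value 0 at sets of size other than l
    matches the default of [entry], so the two agree at all pairs of sets. *)
Definition subset_vector P : 'rV['F_2]_#|{: lsubset U l}| :=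
  if insub P : option (lsubset U l) is Some p then delta_mx 0 (enum_rank p) else 0.

Lemma gram_subset_vector A : gram A subset_vector =2 entry A.
Proof.
move=> P Q; rewrite /gram /subset_vector /entry.
case: insub => [p|]; last by rewrite !mul0mx mxE.
case: insub => [q|]; last by rewrite trmx0 mulmx0 mxE.
by rewrite trmx_delta -rowE -colE !mxE.
Qed.

Lemma is_choose_matrix_form A : (2 <= l)%N -> is_choose_matrix A ->
  choose_form l [set: U] (gram A subset_vector).
Proof.
move=> l2 [symA ind lin non]; split.
- move=> P Q _ _ cP cQ dPQ; rewrite gram_subset_vector ind //.
  by apply/eqP; rewrite setI_eq0.
- move=> F P _ _ cF cP; rewrite -[RHS](lin F P) //.
  by apply: eq_bigr => i _; rewrite gram_subset_vector.
- move=> i a F _ FX cF aF; rewrite -[RHS](non i F) // (@halving_sumE A i a) //.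
  by apply: eq_bigr => s _; rewrite gram_subset_vector.
Qed.
End Entries.

(** * The bounds over the rationals *)

Theorem theorem1p6 (l m : nat) (hl : (3 <= l)%N) (hm : (1 <= m)%N)
    (A : subset_matrix 'I_m l) (hA : is_choose_matrix A) :
  (m%:R - 2 * l%:R + 2) / (l%:R - 1) <= (\rank A)%:R :> rat /\
  (even_matrix A -> 2 * (m%:R - 2 * l%:R + 2) / l%:R <= (\rank A)%:R :> rat).
Proof.
have symA := cm_symmetric hA; have cA := is_choose_matrix_form (ltnW hl) hA.
have l3 : 3 <= l%:R :> rat by rewrite ler_nat.
split=> [|evenA].
  have := choose_form_rank hl symA cA; rewrite cardsT card_ord => h.
  rewrite ler_pdivrMr; last lra.
  (* Truncated subtraction is cleared before casting to [rat]. *)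
  have {h} : (m + 2 + \rank A <= 2 * l + l * \rank A)%N by nia.
  by rewrite -(ler_nat rat) !natrD !natrM; lra.
have := @even_choose_form_rank _ _ _ _ _ _ (ltnW hl) symA cA; rewrite cardsT card_ord => h.
rewrite ler_pdivrMr; last lra.
have {h} : (2 * m + 4 <= 4 * l + l * \rank A)%N.
  suff : (2 * m <= 2 * (2 * l - 2) + l * \rank A)%N by nia.
  apply: h => P _ _; rewrite gram_subset_vector /entry.
  by case: insub => // p; apply: evenA.
by rewrite -(ler_nat rat) !natrD !natrM; lra.
Qed.
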